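(* Let $R$ be a commutative ring with $1\neq 0$ and let $I$ be a 1-absorbing primary ideal of $R$. Then $\sqrt{I}$ is a prime ideal of $R$.
   Context: All rings are commutative with $1\neq 0$. For an ideal $I$ of $R$, $\sqrt{I}=\{r\in R \mid r^{n}\in I \text{ for some integer } n\geq 1\}$. A proper ideal $I$ of $R$ is called a 1-absorbing primary ideal of $R$ if whenever $a,b,c\in R$ are nonunit elements with $abc\in I$, then $ab\in I$ or $c\in\sqrt{I}$. *)

(* Defs.v *)
From HB Require Import structures.
From mathcomp Require Import all_boot all_algebra.
From mathcomp Require Import boolp classical_sets.

Set Implicit Arguments.
Unset Strict Implicit.
Unset Printing Implicit Defensive.

Import GRing.Theory.
Local Open Scope ring_scope.
Local Open Scope classical_set_scope.

(* Subsets of R are taken in [set R], so that no decidability of membership is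
   assumed; [mem I] is the (classical) boolean predicate required by the ideal
   predicates of ring_quotient. *)

(* [comNzRingType] has no built-in notion of unit, and [comUnitRingType] would
   add the data of a boolean unit test and an inverse function. *)
Definition is_unit (R : comNzRingType) (x : R) : Prop :=
  exists y : R, y * x = 1.

Definition radical (R : comNzRingType) (I : set R) : set R :=
  [set r | exists2 n : nat, (1 <= n)%N & I (r ^+ n)].

(* [idealr_closed] contains the condition 1 \notin I. *)
Definition is_proper_ideal (R : comNzRingType) (I : set R) : Prop :=
  idealr_closed (mem I).

Definition is_prime_ideal (R : comNzRingType) (P : set R) : Prop :=
  is_proper_ideal P /\ prime_idealr_closed (mem P).

Definition one_absorbing_primary (R : comNzRingType) (I : set R) : Prop :=
  is_proper_ideal I /\
  forall a b c : R, ~ is_unit a -> ~ is_unit b -> ~ is_unit c ->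
    I (a * b * c) -> I (a * b) \/ radical I c.

(* Main.v *)
(** Suppose [(a b)^n] lies in [I].  If neither [a] nor [b] is a unit, then
    [a^n * a^n * b^(2n)] is a product of three nonunits in [I], so that
    [a^(2n)] lies in [I] or [b^(2n)] lies in the radical of [I]. *)
Require Import Defs.
From HB Require Import structures.
From mathcomp Require Import all_boot all_algebra.
From mathcomp Require Import boolp classical_sets.

Set Implicit Arguments.
Unset Strict Implicit.
Unset Printing Implicit Defensive.

Import GRing.Theory.
Local Open Scope ring_scope.
Local Open Scope classical_set_scope.

(** Passes from the boolean predicate [mem I] to plain membership in [I], so that later arguments
    never handle the coercion. *)
Lemma is_proper_idealP (R : comNzRingType) (I : set R) :
  is_proper_ideal I <->
  [/\ I 0, ~ I 1 & forall a u v : R, I u -> I v -> I (a * u + v)].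
Proof.
split=> [[I0 I1 Iadd]|[I0 I1 Iadd]].
- split=> [||a u v Iu Iv]; first exact: set_mem.
  + by move=> /mem_set; apply/negP.
  + by apply/set_mem/Iadd; apply: mem_set.
- split=> [||a u v /set_mem Iu /set_mem Iv]; first exact: mem_set.
  + by apply/negP => /set_mem.
  + by apply: mem_set; apply: Iadd.
Qed.

Lemma proper_idealMl (R : comNzRingType) (I : set R) (a u : R) :
  is_proper_ideal I -> I u -> I (a * u).
Proof. by move=> /is_proper_idealP[I0 _ Iadd] Iu; rewrite -[_ * _]addr0; apply: Iadd. Qed.

Lemma proper_idealD (R : comNzRingType) (I : set R) (u v : R) :
  is_proper_ideal I -> I u -> I v -> I (u + v).
Proof. by move=> /is_proper_idealP[_ _ Iadd] Iu Iv; rewrite -[u]mul1r; apply: Iadd. Qed.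

Lemma proper_ideal_exp_leq (R : comNzRingType) (I : set R) (u : R) (m n : nat) :
  is_proper_ideal I -> (m <= n)%N -> I (u ^+ m) -> I (u ^+ n).
Proof. by move=> idI /subnK <- Ium; rewrite exprD; apply: proper_idealMl. Qed.

Lemma radicalMl (R : comNzRingType) (I : set R) (a u : R) :
  is_proper_ideal I -> radical I u -> radical I (a * u).
Proof.
by move=> idI [n n_gt0 Iun]; exists n; rewrite // exprMn; apply: proper_idealMl.
Qed.

(** Expand [(u + v) ^+ (m + n)] by the binomial formula: in the term with [v ^+ i], either [n <= i],
    or [i < n] and the exponent [m + n - i] of [u] is at least [m]. *)
Lemma radicalD (R : comNzRingType) (I : set R) (u v : R) :
  is_proper_ideal I -> radical I u -> radical I v -> radical I (u + v).
Proof.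
move=> idI [m m_gt0 Ium] [n n_gt0 Ivn]; exists (m + n)%N; first exact: ltn_addr.
have [I0 _ _] := (is_proper_idealP I).1 idI.
rewrite exprDn; elim/big_ind: _ => // [x y|i _]; first exact: proper_idealD.
(* The binomial coefficient becomes a ring factor, which the ideal absorbs. *)
rewrite -mulr_natl; apply: proper_idealMl => //.
have [le_ni|lt_in] := leqP n i.
  by apply: proper_idealMl => //; apply: proper_ideal_exp_leq Ivn.
rewrite mulrC; apply: proper_idealMl => //; apply: proper_ideal_exp_leq Ium => //.
by rewrite -addnBA ?leq_addr // ltnW.
Qed.

Lemma radical_proper_ideal (R : comNzRingType) (I : set R) :
  is_proper_ideal I -> is_proper_ideal (radical I).
Proof.
move=> idI; have [I0 I1 _] := (is_proper_idealP I).1 idI.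
apply/is_proper_idealP; split=> [|[n _]|a u v Iu Iv].
- by exists 1%N; rewrite ?expr1.
- by rewrite expr1n.
- by apply: radicalD => //; apply: radicalMl.
Qed.

Lemma radical_exp (R : comNzRingType) (I : set R) (u : R) (n : nat) :
  (0 < n)%N -> radical I (u ^+ n) -> radical I u.
Proof.
by move=> n_gt0 [m m_gt0 Iunm]; exists (n * m)%N; rewrite ?muln_gt0 ?n_gt0 // exprM.
Qed.

Lemma radical_unitMl (R : comNzRingType) (I : set R) (a b : R) :
  is_proper_ideal I -> is_unit a -> radical I (a * b) -> radical I b.
Proof.
by move=> idI [y ya] /(radicalMl y idI); rewrite mulrA ya mul1r.
Qed.

(** An inverse of a positive power, times the remaining factors [a], inverts [a]. Used in
    contrapositive form: positive powers of nonunits are nonunits. *)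
Lemma is_unit_exp (R : comNzRingType) (a : R) (n : nat) :
  (0 < n)%N -> is_unit (a ^+ n) -> is_unit a.
Proof. by case: n => // n _ [y yan]; exists (y * a ^+ n); rewrite -mulrA -exprSr. Qed.

Theorem theorem2 (R : comNzRingType) (I : set R) :
  one_absorbing_primary I -> is_prime_ideal (radical I).
Proof.
move=> [idI absI]; split; first exact: radical_proper_ideal.
move=> a b /set_mem rad_ab; apply/orP.
suff [rad_a|rad_b] : radical I a \/ radical I b by [left; apply: mem_set|right; apply: mem_set].
(* The absorbing condition constrains nonunits only, so units are treated first: a unit factor
   cancels from [a * b] inside the radical. *)
have [Ua|NUa] := pselect (is_unit a); first by right; apply: radical_unitMl Ua _.
have [Ub|NUb] := pselect (is_unit b).
  by left; apply: radical_unitMl Ub _; rewrite // mulrC.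
have [n n_gt0 Iabn] := rad_ab.
have nn_gt0 : (0 < n + n)%N by apply: ltn_addr.
have Nan : ~ is_unit (a ^+ n) by move/(is_unit_exp n_gt0).
have Nbnn : ~ is_unit (b ^+ (n + n)) by move/(is_unit_exp nn_gt0).
(* The exponent of [b] is doubled to match the two factors [a ^+ n]: the product is then
   [(a * b) ^+ (n + n)], a multiple of [(a * b) ^+ n]. *)
have Iprod : I (a ^+ n * a ^+ n * b ^+ (n + n)).
  by rewrite -exprD -exprMn exprD; apply: proper_idealMl.
have [Iann|] := absI _ _ _ Nan Nan Nbnn Iprod.
- by left; exists (n + n)%N; rewrite // exprD.
- by move/(radical_exp nn_gt0); right.
Qed.
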